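(* Let $(\mathcal C,\otimes)$ be a $K$-linear Gray semigroup. Then the $\psi$-equivalence classes of first order associator-deformations of $(\mathcal C,\otimes)$ are in bijection with the elements of $H^2_{ass}(\mathcal C)$.
   Context: Conventions. $K$ is a commutative ring with unit. In a (strict) 2-category, $id_X$ is the identity 1-morphism, $1_f$ the identity 2-morphism, $\sigma\cdot\tau$ the vertical composite (first $\tau$), and $\circ$ denotes composition of 1-morphisms ($g\circ f$: first $f$) and horizontal composition of 2-morphisms. A 2-category is $K$-linear if its sets of 2-morphisms are $K$-modules and vertical and horizontal composition are $K$-bilinear. Gray semigroup. A Gray semigroup $(\mathcal C,\otimes)$ is a 2-category $\mathcal C$ with objects $X\otimes Y$, functors $\mathcal C(X,X')\times\mathcal C(Y,Y')\to\mathcal C(X\otimes Y,X'\otimes Y')$ written $(f,g)\mapsto f\otimes g$, $(\tau,\sigma)\mapsto\tau\otimes\sigma$, and 2-isomorphisms $\widehat\otimes((f',g'),(f,g)):(f'\otimes g')\circ(f\otimes g)\Rightarrow(f'\circ f)\otimes(g'\circ g)$, natural in all arguments, such that: $id_X\otimes id_Y=id_{X\otimes Y}$; $\widehat\otimes((f'',g''),(f'\circ f,g'\circ g))\cdot(1_{f''\otimes g''}\circ\widehat\otimes((f',g'),(f,g)))=\widehat\otimes((f''\circ f',g''\circ g'),(f,g))\cdot(\widehat\otimes((f'',g''),(f',g'))\circ1_{f\otimes g})$; $\widehat\otimes((id,id),(f,g))$ and $\widehat\otimes((f,g),(id,id))$ are identities; (cubical) all $\widehat\otimes((f',id),(f,g))$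 and $\widehat\otimes((f,g'),(id,g))$ are identities; $\otimes$ is strictly associative on objects, 1-morphisms and 2-morphisms; and $(\widehat\otimes((f',g'),(f,g))\otimes1_{h'\circ h})\cdot\widehat\otimes((f'\otimes g',h'),(f\otimes g,h))=(1_{f'\circ f}\otimes\widehat\otimes((g',h'),(g,h)))\cdot\widehat\otimes((f',g'\otimes h'),(f,g\otimes h))$. It is $K$-linear if $\mathcal C$ is $K$-linear and $(\tau,\sigma)\mapsto\tau\otimes\sigma$ is $K$-bilinear. Deformations. Let $\mathcal C_\epsilon$ have the same objects and 1-morphisms as $\mathcal C$, with 2-morphisms $\tau_0+\tau_1\epsilon$ ($\tau_0,\tau_1$ parallel 2-morphisms of $\mathcal C$, $\epsilon^2=0$); vertical and horizontal compositions and $\otimes$ of 2-morphisms are extended $K[\epsilon]/(\epsilon^2)$-bilinearly. A first order associator-deformation is a family $\widehat a_\epsilon(f,g,h)=1_{f\otimes g\otimes h}+\widehat a^{(1)}(f,g,h)\epsilon$ of 2-isomorphisms of $\mathcal C_\epsilon$ (all other structure, including $\widehat\otimes$, the identity associator 1-morphisms and the trivial pentagonator, being unchanged) defining a semigroupal structure on $\mathcal C_\epsilon$, i.e.: $\widehat a_\epsilon$ is natural in $(f,g,h)$; $\widehat a_\epsilon(id_X,id_Y,id_Z)$ is the identity; $\widehat a_\epsilon(f'f,g'g,h'h)\cdot(\widehat\otimes((f',g'),(f,g))\otimes1_{h'h})\cdot\widehat\otimes((f'\otimes g',h'),(f\otimes g,h))=(1_{f'f}\otimes\widehat\otimes((g',h'),(g,h)))\cdot\widehat\otimes((f',g'\otimes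 h'),(f,g\otimes h))\cdot(\widehat a_\epsilon(f',g',h')\circ1_{f\otimes g\otimes h})\cdot(1_{f'\otimes g'\otimes h'}\circ\widehat a_\epsilon(f,g,h))$; and $\widehat a_\epsilon(f,g,h\otimes k)\cdot\widehat a_\epsilon(f\otimes g,h,k)=(1_f\otimes\widehat a_\epsilon(g,h,k))\cdot\widehat a_\epsilon(f,g\otimes h,k)\cdot(\widehat a_\epsilon(f,g,h)\otimes1_k)$. $\psi$-equivalence. Two such deformations $\widehat a_\epsilon$, $\widehat a'_\epsilon$ are $\psi$-equivalent if the identity 2-functor of $\mathcal C_\epsilon$ admits a semigroupal structure $(\psi,\omega)$ with $\psi_{X,Y}=id_{X\otimes Y}$, $\widehat\psi(f,g)$ the identity mod $\epsilon$, and $\omega$ trivial; explicitly, there are 2-isomorphisms $\widehat\psi(f,g)=1_{f\otimes g}+\widehat\psi^{(1)}(f,g)\epsilon$, natural in $(f,g)$, with $\widehat\psi(id,id)=1$, $\widehat\psi(f'f,g'g)\cdot\widehat\otimes((f',g'),(f,g))=\widehat\otimes((f',g'),(f,g))\cdot(\widehat\psi(f',g')\circ1_{f\otimes g})\cdot(1_{f'\otimes g'}\circ\widehat\psi(f,g))$, and $(1_f\otimes\widehat\psi(g,h))\cdot\widehat\psi(f,g\otimes h)\cdot\widehat a_\epsilon(f,g,h)=\widehat a'_\epsilon(f,g,h)\cdot(\widehat\psi(f,g)\otimes1_h)\cdot\widehat\psi(f\otimes g,h)$. Double complex. For $m,n\ge1$ let $X^{m-1,n-1}(\mathcal C)$ be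 the $K$-module of families $\phi$ of 2-morphisms $\phi(f_0,\dots,f_{m-1}):T_0\circ\cdots\circ T_{m-1}\Rightarrow c^1\otimes\cdots\otimes c^n$, one for each sequence of composable $n$-tuples $f_j=(f_j^1,\dots,f_j^n)$ of 1-morphisms ($f_{m-1}$ applied first), where $T_j=f_j^1\otimes\cdots\otimes f_j^n$ and $c^k=f_0^k\circ\cdots\circ f_{m-1}^k$, natural with respect to 2-morphisms in all $f_j^k$. Composites $f_{j-1}\circ f_j$ are componentwise. For pairs $p_j=(f_j,g_j)$ put $\Theta_2(p_0)=1$, $\Theta_2(p_0,\dots,p_{m-1})=\widehat\otimes(p_0,p_1\circ\cdots\circ p_{m-1})\cdot(1_{f_0\otimes g_0}\circ\Theta_2(p_1,\dots,p_{m-1}))$. Put $\Theta_1=1$ and $\Theta_n((f_j^1,\dots,f_j^n)_j)=(1_{c^1}\otimes\Theta_{n-1}((f_j^2,\dots,f_j^n)_j))\cdot\Theta_2((f_j^1,f_j^2\otimes\cdots\otimes f_j^n)_j)$ for $n\geq 3$. Define $\delta_h:X^{m-1,n-1}(\mathcal C)\to X^{m,n-1}(\mathcal C)$ by $$(\delta_h\phi)(f_0,\dots,f_m)=\Theta_n(f_0,f_1\circ\cdots\circ f_m)\cdot(1_{T_0}\circ\phi(f_1,\dots,f_m))+\sum_{i=1}^m(-1)^i\phi(\dots,f_{i-1}\circ f_i,\dots)\cdot(1\circ\Theta_n(f_{i-1},f_i)\circ1)+(-1)^{m+1}\Theta_n(f_0\circ\cdots\circ f_{m-1},f_m)\cdot(\phi(f_0,\dots,f_{m-1})\circ1_{T_m}),$$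 where the outer $1$'s are identities of the remaining $T_j$'s. Define $\delta_v:X^{m-1,n-1}(\mathcal C)\to X^{m-1,n}(\mathcal C)$, for $f_j=(f_j^0,\dots,f_j^n)$, by $$(\delta_v\phi)(f_0,\dots,f_{m-1})=(1_{c^0}\otimes\phi((f_j^1,\dots,f_j^n)_j))\cdot\Theta_2((f_j^0,f_j^1\otimes\cdots\otimes f_j^n)_j)+\sum_{i=1}^n(-1)^i(1\otimes\Theta_2((f_j^{i-1},f_j^i)_j)\otimes1)\cdot\phi((f_j^0,\dots,f_j^{i-1}\otimes f_j^i,\dots,f_j^n)_j)+(-1)^{n+1}(\phi((f_j^0,\dots,f_j^{n-1})_j)\otimes1_{c^n})\cdot\Theta_2((f_j^0\otimes\cdots\otimes f_j^{n-1},f_j^n)_j),$$ where the outer $1$'s are identities of the remaining $c^k$'s. $\phi\in X^{m-1,n-1}(\mathcal C)$ is special if $\phi(f_0,\dots,f_{m-1})=0$ whenever some $f_i=(id,\dots,id)$; the special elements form $X_s^{m-1,n-1}(\mathcal C)$, which is preserved by $\delta_h,\delta_v$. Associator-deformation complex. $X^n_{ass}(\mathcal C)=\mathrm{Ker}(\delta_h:X_s^{0,n}(\mathcal C)\to X_s^{1,n}(\mathcal C))$, $n\ge0$, with coboundary the restriction of $\delta_v$; $H^\bullet_{ass}(\mathcal C)$ denotes its cohomology. *)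

(* Defs.v *)
From mathcomp Require Import all_boot all_algebra.
From Stdlib Require Import Eqdep.

Set Implicit Arguments.
Unset Strict Implicit.
Unset Printing Implicit Defensive.

Import GRing.Theory.
Local Open Scope ring_scope.

(* Operations of a K-linear Gray semigroup, without its laws.
   [comp g f] is "first f, then g" and [vcomp t s] is "first s, then t";
   [hatT f' g' f g] is the 2-cell written ⊗̂((f',g'),(f,g)). *)
Record gray_data (K : comPzRingType) := GrayData {
  Ob : Type;
  Hom : Ob -> Ob -> Type;
  Hom2 : forall X Y, Hom X Y -> Hom X Y -> lmodType K;
  id1 : forall X, Hom X X;
  comp : forall X Y Z, Hom Y Z -> Hom X Y -> Hom X Z;
  id2 : forall X Y (f : Hom X Y), Hom2 f f;
  vcomp : forall X Y (f g h : Hom X Y), Hom2 g h -> Hom2 f g -> Hom2 f h;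
  hcomp : forall X Y Z (g g' : Hom Y Z) (f f' : Hom X Y),
    Hom2 g g' -> Hom2 f f' -> Hom2 (comp g f) (comp g' f');
  tob : Ob -> Ob -> Ob;
  tens : forall X X' Y Y', Hom X X' -> Hom Y Y' -> Hom (tob X Y) (tob X' Y');
  tens2 : forall X X' Y Y' (f f' : Hom X X') (g g' : Hom Y Y'),
    Hom2 f f' -> Hom2 g g' -> Hom2 (tens f g) (tens f' g');
  hatT : forall X X' X'' Y Y' Y'' (f' : Hom X' X'') (g' : Hom Y' Y'')
      (f : Hom X X') (g : Hom Y Y'),
    Hom2 (comp (tens f' g') (tens f g)) (tens (comp f' f) (comp g' g))
}.

Arguments Hom {K d} _ _ : rename.
Arguments Hom2 {K d X Y} _ _ : rename.
Arguments id1 {K d} _ : rename.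
Arguments comp {K d X Y Z} _ _ : rename.
Arguments id2 {K d X Y} _ : rename.
Arguments vcomp {K d X Y f g h} _ _ : rename.
Arguments hcomp {K d X Y Z g g' f f'} _ _ : rename.
Arguments tob {K d} _ _ : rename.
Arguments tens {K d X X' Y Y'} _ _ : rename.
Arguments tens2 {K d X X' Y Y' f f' g g'} _ _ : rename.
Arguments hatT {K d X X' X'' Y Y' Y''} _ _ _ _ : rename.

Declare Scope gray_scope.
Local Open Scope gray_scope.
Notation "g ∘ f" := (comp g f) (at level 40, left associativity) : gray_scope.
Notation "f ⊗ g" := (tens f g) (at level 38, right associativity) : gray_scope.
Notation "t ⊙ s" := (hcomp t s) (at level 40, left associativity) : gray_scope.
Notation "t ⊠ s" := (tens2 t s) (at level 38, right associativity) : gray_scope.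
Notation "t ∙ s" := (vcomp t s) (at level 45, left associativity) : gray_scope.

(* Strict associativity identifies 1-cells (2-cells) whose types are only
   propositionally equal.  Such strict equations are stated after packing a
   cell with its boundary, and 2-cells are transported along them by [cast]. *)
Section Strict.
Variables (K : comPzRingType) (D : gray_data K).
Implicit Types X Y Z U V W : Ob D.

Definition arr := {XY : Ob D * Ob D & Hom XY.1 XY.2}.
Definition Arr X Y (f : Hom X Y) : arr :=
  existT (fun XY : Ob D * Ob D => Hom XY.1 XY.2) (X, Y) f.

Definition boundary :=
  {XY : Ob D * Ob D & (Hom XY.1 XY.2 * Hom XY.1 XY.2)%type}.
Definition Bd X Y (f g : Hom X Y) : boundary :=
  existT (fun XY : Ob D * Ob D => (Hom XY.1 XY.2 * Hom XY.1 XY.2)%type)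
    (X, Y) (f, g).
Definition cell_of (b : boundary) : lmodType K :=
  Hom2 (projT2 b).1 (projT2 b).2.

Definition cell X Y (f g : Hom X Y) (t : Hom2 f g) : {b : boundary & cell_of b} :=
  existT (fun b => cell_of b : Type) (Bd f g) t.

Lemma Bd_eq X Y (f g : Hom X Y) X' Y' (f' g' : Hom X' Y') :
  Arr f = Arr f' -> Arr g = Arr g' -> Bd f g = Bd f' g'.
Proof.
move=> ef eg; have [eX eY] : (X, Y) = (X', Y')
  := congr1 (fun a : arr => projT1 a) ef.
subst X' Y'.
by rewrite (inj_pair2 _ _ _ _ _ ef) (inj_pair2 _ _ _ _ _ eg).
Qed.

Definition cast X Y (f g : Hom X Y) X' Y' (f' g' : Hom X' Y')
    (ef : Arr f = Arr f') (eg : Arr g = Arr g') (t : Hom2 f g) : Hom2 f' g' :=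
  eq_rect (Bd f g) (fun b => cell_of b : Type) t (Bd f' g') (Bd_eq ef eg).

Definition iso2 X Y (f g : Hom X Y) (t : Hom2 f g) : Prop :=
  exists u : Hom2 g f, u ∙ t = id2 f /\ t ∙ u = id2 g.

Lemma Arr_comp X Y Z (g : Hom Y Z) (f : Hom X Y)
    X' Y' Z' (g' : Hom Y' Z') (f' : Hom X' Y') :
  Arr g = Arr g' -> Arr f = Arr f' -> Arr (g ∘ f) = Arr (g' ∘ f').
Proof.
move=> eg ef.
have [eX eY] : (X, Y) = (X', Y')
  := congr1 (fun a : arr => projT1 a) ef.
have [_ eZ] : (Y, Z) = (Y', Z')
  := congr1 (fun a : arr => projT1 a) eg.
subst X' Y' Z'.
by rewrite (inj_pair2 _ _ _ _ _ ef) (inj_pair2 _ _ _ _ _ eg).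
Qed.

Lemma Arr_tens X X' Y Y' (f : Hom X X') (g : Hom Y Y')
    U U' V V' (f' : Hom U U') (g' : Hom V V') :
  Arr f = Arr f' -> Arr g = Arr g' -> Arr (f ⊗ g) = Arr (f' ⊗ g').
Proof.
move=> ef eg.
have [eX eY] : (X, X') = (U, U')
  := congr1 (fun a : arr => projT1 a) ef.
have [eZ eW] : (Y, Y') = (V, V')
  := congr1 (fun a : arr => projT1 a) eg.
subst U U' V V'.
by rewrite (inj_pair2 _ _ _ _ _ ef) (inj_pair2 _ _ _ _ _ eg).
Qed.

End Strict.

Section Laws.
Variables (K : comPzRingType) (D : gray_data K).

Record is_2category : Prop := Is2Category {
  compA : forall (X Y Z W : Ob D) (h : Hom Z W) (g : Hom Y Z) (f : Hom X Y),
    h ∘ (g ∘ f) = (h ∘ g) ∘ f;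
  comp1f : forall (X Y : Ob D) (f : Hom X Y), id1 Y ∘ f = f;
  compf1 : forall (X Y : Ob D) (f : Hom X Y), f ∘ id1 X = f;
  vcompA : forall (X Y : Ob D) (f g h k : Hom X Y)
      (t : Hom2 h k) (s : Hom2 g h) (r : Hom2 f g), t ∙ (s ∙ r) = (t ∙ s) ∙ r;
  vcomp1t : forall (X Y : Ob D) (f g : Hom X Y) (t : Hom2 f g), id2 g ∙ t = t;
  vcompt1 : forall (X Y : Ob D) (f g : Hom X Y) (t : Hom2 f g), t ∙ id2 f = t;
  hcomp_id2 : forall (X Y Z : Ob D) (g : Hom Y Z) (f : Hom X Y),
    id2 g ⊙ id2 f = id2 (g ∘ f);
  hcomp_vcomp : forall (X Y Z : Ob D) (g g' g'' : Hom Y Z) (f f' f'' : Hom X Y)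
      (t' : Hom2 g' g'') (t : Hom2 g g') (s' : Hom2 f' f'') (s : Hom2 f f'),
    (t' ∙ t) ⊙ (s' ∙ s) = (t' ⊙ s') ∙ (t ⊙ s);
  hcompA : forall (X Y Z W : Ob D) (h h' : Hom Z W) (g g' : Hom Y Z)
      (f f' : Hom X Y) (t : Hom2 h h') (s : Hom2 g g') (r : Hom2 f f'),
    cell (t ⊙ (s ⊙ r)) = cell ((t ⊙ s) ⊙ r);
  hcomp1t : forall (X Y : Ob D) (f g : Hom X Y) (t : Hom2 f g),
    cell (id2 (id1 Y) ⊙ t) = cell t;
  hcompt1 : forall (X Y : Ob D) (f g : Hom X Y) (t : Hom2 f g),
    cell (t ⊙ id2 (id1 X)) = cell t
}.

Record is_klinear : Prop := IsKLinear {
  vcomp_linl : forall (X Y : Ob D) (f g h : Hom X Y) (s : Hom2 f g),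
    linear (fun t : Hom2 g h => t ∙ s);
  vcomp_linr : forall (X Y : Ob D) (f g h : Hom X Y) (t : Hom2 g h),
    linear (fun s : Hom2 f g => t ∙ s);
  hcomp_linl : forall (X Y Z : Ob D) (g g' : Hom Y Z) (f f' : Hom X Y)
      (s : Hom2 f f'), linear (fun t : Hom2 g g' => t ⊙ s);
  hcomp_linr : forall (X Y Z : Ob D) (g g' : Hom Y Z) (f f' : Hom X Y)
      (t : Hom2 g g'), linear (fun s : Hom2 f f' => t ⊙ s);
  tens2_linl : forall (X X' Y Y' : Ob D) (f f' : Hom X X') (g g' : Hom Y Y')
      (s : Hom2 g g'), linear (fun t : Hom2 f f' => t ⊠ s);
  tens2_linr : forall (X X' Y Y' : Ob D) (f f' : Hom X X') (g g' : Hom Y Y')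
      (t : Hom2 f f'), linear (fun s : Hom2 g g' => t ⊠ s)
}.

Record is_gray : Prop := IsGray {
  tens2_id2 : forall (X X' Y Y' : Ob D) (f : Hom X X') (g : Hom Y Y'),
    id2 f ⊠ id2 g = id2 (f ⊗ g);
  tens2_vcomp : forall (X X' Y Y' : Ob D) (f f' f'' : Hom X X')
      (g g' g'' : Hom Y Y') (t' : Hom2 f' f'') (t : Hom2 f f')
      (s' : Hom2 g' g'') (s : Hom2 g g'),
    (t' ∙ t) ⊠ (s' ∙ s) = (t' ⊠ s') ∙ (t ⊠ s);
  hatT_iso : forall (X X' X'' Y Y' Y'' : Ob D) (f' : Hom X' X'')
      (g' : Hom Y' Y'') (f : Hom X X') (g : Hom Y Y'), iso2 (hatT f' g' f g);
  hatT_natural : forall (X X' X'' Y Y' Y'' : Ob D)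
      (f' k' : Hom X' X'') (g' l' : Hom Y' Y'') (f k : Hom X X') (g l : Hom Y Y')
      (t' : Hom2 f' k') (s' : Hom2 g' l') (t : Hom2 f k) (s : Hom2 g l),
    hatT k' l' k l ∙ ((t' ⊠ s') ⊙ (t ⊠ s))
      = ((t' ⊙ t) ⊠ (s' ⊙ s)) ∙ hatT f' g' f g;
  tens_id1 : forall X Y : Ob D, id1 X ⊗ id1 Y = id1 (tob X Y);
  hatT_comp : forall (X X' X'' X3 Y Y' Y'' Y3 : Ob D)
      (f'' : Hom X'' X3) (g'' : Hom Y'' Y3) (f' : Hom X' X'') (g' : Hom Y' Y'')
      (f : Hom X X') (g : Hom Y Y'),
    cell (hatT f'' g'' (f' ∘ f) (g' ∘ g) ∙ (id2 (f'' ⊗ g'') ⊙ hatT f' g' f g))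
    = cell (hatT (f'' ∘ f') (g'' ∘ g') f g ∙ (hatT f'' g'' f' g' ⊙ id2 (f ⊗ g)));
  hatT_idl : forall (X X' Y Y' : Ob D) (f : Hom X X') (g : Hom Y Y'),
    cell (hatT (id1 X') (id1 Y') f g) = cell (id2 (f ⊗ g));
  hatT_idr : forall (X X' Y Y' : Ob D) (f : Hom X X') (g : Hom Y Y'),
    cell (hatT f g (id1 X) (id1 Y)) = cell (id2 (f ⊗ g));
  hatT_cubl : forall (X X' X'' Y Y' : Ob D) (f' : Hom X' X'') (f : Hom X X')
      (g : Hom Y Y'),
    cell (hatT f' (id1 Y') f g) = cell (id2 ((f' ∘ f) ⊗ g));
  hatT_cubr : forall (X X' Y Y' Y'' : Ob D) (f : Hom X X') (g' : Hom Y' Y'')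
      (g : Hom Y Y'),
    cell (hatT f g' (id1 X) g) = cell (id2 (f ⊗ (g' ∘ g)));
  tobA : forall X Y Z : Ob D, tob X (tob Y Z) = tob (tob X Y) Z;
  tensA : forall (X X' Y Y' Z Z' : Ob D) (f : Hom X X') (g : Hom Y Y')
      (h : Hom Z Z'), Arr (f ⊗ (g ⊗ h)) = Arr ((f ⊗ g) ⊗ h);
  tens2A : forall (X X' Y Y' Z Z' : Ob D) (f f' : Hom X X') (g g' : Hom Y Y')
      (h h' : Hom Z Z') (t : Hom2 f f') (s : Hom2 g g') (r : Hom2 h h'),
    cell (t ⊠ (s ⊠ r)) = cell ((t ⊠ s) ⊠ r);
  hatT_tens : forall (X X' X'' Y Y' Y'' Z Z' Z'' : Ob D)
      (f' : Hom X' X'') (g' : Hom Y' Y'') (h' : Hom Z' Z'')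
      (f : Hom X X') (g : Hom Y Y') (h : Hom Z Z'),
    cell ((hatT f' g' f g ⊠ id2 (h' ∘ h)) ∙ hatT (f' ⊗ g') h' (f ⊗ g) h)
    = cell ((id2 (f' ∘ f) ⊠ hatT g' h' g h) ∙ hatT f' (g' ⊗ h') f (g ⊗ h))
}.

End Laws.

Record graySemigroup (K : comPzRingType) := GraySemigroup {
  gdata :> gray_data K;
  gray_2category : is_2category gdata;
  gray_klinear : is_klinear gdata;
  gray_gray : is_gray gdata
}.

(* C_ε: the pair (t0, t1) stands for t0 + t1 ε, with ε² = 0. *)
Definition dual (K : comPzRingType) (D : gray_data K) : gray_data K :=
  @GrayData K (Ob D) (@Hom K D)
    (fun X Y f g => (Hom2 f g * Hom2 f g)%type : lmodType K)
    (@id1 K D) (@comp K D)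
    (fun X Y f => (id2 f, 0))
    (fun X Y f g h t s => (t.1 ∙ s.1, t.1 ∙ s.2 + t.2 ∙ s.1))
    (fun X Y Z g g' f f' t s => (t.1 ⊙ s.1, t.1 ⊙ s.2 + t.2 ⊙ s.1))
    (@tob K D) (@tens K D)
    (fun X X' Y Y' f f' g g' t s => (t.1 ⊠ s.1, t.1 ⊠ s.2 + t.2 ⊠ s.1))
    (fun X X' X'' Y Y' Y'' f' g' f g => (hatT f' g' f g, 0)).

Definition eps_cell (K : comPzRingType) (D : gray_data K) (X Y : Ob D)
    (f g : Hom X Y) (t0 t1 : Hom2 f g) : @Hom2 K (dual D) X Y f g := (t0, t1).

(* Three-fold tensor products are bracketed to the right; the strict
   associativity [tA] is used to bring every term to that bracketing. *)
Section Semigroupal.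
Variables (K : comPzRingType) (D : gray_data K).
Implicit Types X Y Z U V W : Ob D.

Definition strict_tensA : Prop :=
  forall (X X' Y Y' Z Z' : Ob D) (f : Hom X X') (g : Hom Y Y') (h : Hom Z Z'),
    Arr (f ⊗ (g ⊗ h)) = Arr ((f ⊗ g) ⊗ h).
Hypothesis tA : strict_tensA.

Definition family2 := forall (X X' Y Y' : Ob D) (f : Hom X X') (g : Hom Y Y'),
  Hom2 (f ⊗ g) (f ⊗ g).
Definition family3 := forall (X X' Y Y' Z Z' : Ob D)
  (f : Hom X X') (g : Hom Y Y') (h : Hom Z Z'), Hom2 (f ⊗ g ⊗ h) (f ⊗ g ⊗ h).

Definition castA X X' Y Y' Z Z' (f : Hom X X') (g : Hom Y Y') (h : Hom Z Z')
    (t : Hom2 ((f ⊗ g) ⊗ h) ((f ⊗ g) ⊗ h)) : Hom2 (f ⊗ g ⊗ h) (f ⊗ g ⊗ h) :=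
  cast (esym (tA f g h)) (esym (tA f g h)) t.

Lemma tens4A X X' Y Y' Z Z' W W' (f : Hom X X') (g : Hom Y Y') (h : Hom Z Z')
    (k : Hom W W') : Arr (f ⊗ (g ⊗ h) ⊗ k) = Arr (f ⊗ g ⊗ h ⊗ k).
Proof. by apply: Arr_tens. Qed.

Lemma tens4Al X X' Y Y' Z Z' W W' (f : Hom X X') (g : Hom Y Y') (h : Hom Z Z')
    (k : Hom W W') : Arr ((f ⊗ g ⊗ h) ⊗ k) = Arr (f ⊗ g ⊗ h ⊗ k).
Proof. by rewrite -tA; apply: tens4A. Qed.

Lemma compA3 X X' X'' Y Y' Y'' Z Z' Z''
    (f' : Hom X' X'') (g' : Hom Y' Y'') (h' : Hom Z' Z'')
    (f : Hom X X') (g : Hom Y Y') (h : Hom Z Z') :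
  Arr (((f' ⊗ g') ⊗ h') ∘ ((f ⊗ g) ⊗ h)) = Arr ((f' ⊗ g' ⊗ h') ∘ (f ⊗ g ⊗ h)).
Proof. by apply: Arr_comp. Qed.

(* [a] completes ⊗, ⊗̂, the identity associator 1-morphisms and the identity
   pentagonator to a semigroupal structure. *)
Record is_associator (a : family3) : Prop := IsAssociator {
  assoc_iso : forall X X' Y Y' Z Z' (f : Hom X X') (g : Hom Y Y') (h : Hom Z Z'),
    iso2 (a _ _ _ _ _ _ f g h);
  assoc_natural : forall X X' Y Y' Z Z' (f f' : Hom X X') (g g' : Hom Y Y')
      (h h' : Hom Z Z') (t : Hom2 f f') (s : Hom2 g g') (r : Hom2 h h'),
    a _ _ _ _ _ _ f' g' h' ∙ (t ⊠ s ⊠ r) = (t ⊠ s ⊠ r) ∙ a _ _ _ _ _ _ f g h;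
  assoc_id : forall X Y Z : Ob D,
    a _ _ _ _ _ _ (id1 X) (id1 Y) (id1 Z) = id2 (id1 X ⊗ id1 Y ⊗ id1 Z);
  assoc_comp : forall X X' X'' Y Y' Y'' Z Z' Z''
      (f' : Hom X' X'') (g' : Hom Y' Y'') (h' : Hom Z' Z'')
      (f : Hom X X') (g : Hom Y Y') (h : Hom Z Z'),
    a _ _ _ _ _ _ (f' ∘ f) (g' ∘ g) (h' ∘ h)
      ∙ cast (compA3 f' g' h' f g h) (esym (tA (f' ∘ f) (g' ∘ g) (h' ∘ h)))
          ((hatT f' g' f g ⊠ id2 (h' ∘ h)) ∙ hatT (f' ⊗ g') h' (f ⊗ g) h)
    = (id2 (f' ∘ f) ⊠ hatT g' h' g h)
      ∙ hatT f' (g' ⊗ h') f (g ⊗ h)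
      ∙ (a _ _ _ _ _ _ f' g' h' ⊙ id2 (f ⊗ g ⊗ h))
      ∙ (id2 (f' ⊗ g' ⊗ h') ⊙ a _ _ _ _ _ _ f g h);
  assoc_pentagon : forall X X' Y Y' Z Z' W W' (f : Hom X X') (g : Hom Y Y')
      (h : Hom Z Z') (k : Hom W W'),
    a _ _ _ _ _ _ f g (h ⊗ k) ∙ castA (a _ _ _ _ _ _ (f ⊗ g) h k)
    = (id2 f ⊠ a _ _ _ _ _ _ g h k)
      ∙ cast (tens4A f g h k) (tens4A f g h k) (a _ _ _ _ _ _ f (g ⊗ h) k)
      ∙ cast (tens4Al f g h k) (tens4Al f g h k) (a _ _ _ _ _ _ f g h ⊠ id2 k)
}.

(* ([psi], trivial ω) is a semigroupal structure on the identity 2-functor,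
   from the semigroupal structure given by [a] to the one given by [a']. *)
Record is_psi_structure (a a' : family3) (psi : family2) : Prop :=
    IsPsiStructure {
  psi_iso : forall X X' Y Y' (f : Hom X X') (g : Hom Y Y'),
    iso2 (psi _ _ _ _ f g);
  psi_natural : forall X X' Y Y' (f f' : Hom X X') (g g' : Hom Y Y')
      (t : Hom2 f f') (s : Hom2 g g'),
    psi _ _ _ _ f' g' ∙ (t ⊠ s) = (t ⊠ s) ∙ psi _ _ _ _ f g;
  psi_id : forall X Y : Ob D, psi _ _ _ _ (id1 X) (id1 Y) = id2 (id1 X ⊗ id1 Y);
  psi_comp : forall X X' X'' Y Y' Y'' (f' : Hom X' X'') (g' : Hom Y' Y'')
      (f : Hom X X') (g : Hom Y Y'),
    psi _ _ _ _ (f' ∘ f) (g' ∘ g) ∙ hatT f' g' f g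
    = hatT f' g' f g ∙ (psi _ _ _ _ f' g' ⊙ id2 (f ⊗ g))
      ∙ (id2 (f' ⊗ g') ⊙ psi _ _ _ _ f g);
  psi_assoc : forall X X' Y Y' Z Z' (f : Hom X X') (g : Hom Y Y') (h : Hom Z Z'),
    (id2 f ⊠ psi _ _ _ _ g h) ∙ psi _ _ _ _ f (g ⊗ h) ∙ a _ _ _ _ _ _ f g h
    = a' _ _ _ _ _ _ f g h ∙ castA (psi _ _ _ _ f g ⊠ id2 h)
      ∙ castA (psi _ _ _ _ (f ⊗ g) h)
}.

End Semigroupal.

Section Deformations.
Variables (K : comPzRingType) (C : graySemigroup K).

Lemma dual_tensA : strict_tensA (dual C).
Proof. exact: (tensA (gray_gray C)). Qed.

Definition eps2 (psi1 : family2 C) : family2 (dual C) :=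
  fun X X' Y Y' f g => eps_cell (id2 _) (psi1 X X' Y Y' f g).
Definition eps3 (a1 : family3 C) : family3 (dual C) :=
  fun X X' Y Y' Z Z' f g h => eps_cell (id2 _) (a1 X X' Y Y' Z Z' f g h).

Record associator_deformation := AssociatorDeformation {
  assoc1 : family3 C;
  assoc1P : is_associator dual_tensA (eps3 assoc1)
}.

Definition psi_equivalent (a a' : associator_deformation) : Prop :=
  exists psi1 : family2 C,
    is_psi_structure dual_tensA (eps3 (assoc1 a)) (eps3 (assoc1 a')) (eps2 psi1).

End Deformations.

(* Composable sequences: [chain H p X Y] consists of (f_0, ..., f_p) with f_p
   starting at X (applied first) and f_0 ending at Y. *)
Section Chains.

Section Chain.
Variables (O : Type) (H : O -> O -> Type).

Fixpoint chain (p : nat) (X Y : O) : Type :=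
  if p is p'.+1 then {Z : O & (H Z Y * chain p' X Z)%type} else H X Y.

Variable c : forall X Y Z, H Y Z -> H X Y -> H X Z.

(* f_0 ∘ (f_1 ∘ (... ∘ f_p)) *)
Fixpoint ccomp (p : nat) : forall X Y, chain p X Y -> H X Y :=
  match p with
  | 0 => fun X Y s => s
  | p'.+1 => fun X Y s => c (projT2 s).1 (ccomp (projT2 s).2)
  end.

(* (f_0, ..., f_i ∘ f_(i+1), ..., f_p) *)
Fixpoint cmerge (p i : nat) : forall X Y, chain p.+1 X Y -> chain p X Y :=
  match p with
  | 0 => fun X Y s => c (projT2 s).1 (projT2 s).2
  | p'.+1 => match i with
    | 0 => fun X Y s =>
        let r := projT2 (projT2 s).2 in
        existT _ (projT1 (projT2 s).2) (c (projT2 s).1 r.1, r.2)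
    | i'.+1 => fun X Y s =>
        existT _ (projT1 s) ((projT2 s).1, cmerge i' (projT2 s).2)
    end
  end.

(* ((f_0, ..., f_(p-1)), f_p) *)
Fixpoint unsnoc (p : nat) :
    forall X Y, chain p.+1 X Y -> {Z : O & (chain p Z Y * H X Z)%type} :=
  match p with
  | 0 => fun X Y s => s
  | p'.+1 => fun X Y s =>
      let u := unsnoc (projT2 s).2 in
      existT (fun Z => (chain p'.+1 Z Y * H X Z)%type) (projT1 u)
        (existT _ (projT1 s) ((projT2 s).1, (projT2 u).1), (projT2 u).2)
  end.

Hypothesis cA : forall X Y Z W (h : H Z W) (g : H Y Z) (f : H X Y),
  c h (c g f) = c (c h g) f.

Lemma ccomp_merge p i X Y (s : chain p.+1 X Y) : ccomp (cmerge i s) = ccomp s.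
Proof. by elim: p i X Y s => [|p IHp] [|i] X Y [Z [f r]] //=; rewrite IHp. Qed.

Lemma ccomp_unsnoc p X Y (s : chain p.+1 X Y) :
  c (ccomp (projT2 (unsnoc s)).1) (projT2 (unsnoc s)).2 = ccomp s.
Proof. by elim: p X Y s => [|p IHp] X Y [Z [f r]] //=; rewrite -cA IHp. Qed.

End Chain.

Section Map.
Variables (O O' : Type) (H : O -> O -> Type) (H' : O' -> O' -> Type).
Variables (o : O -> O') (h : forall X Y, H X Y -> H' (o X) (o Y)).

Fixpoint cmap (p : nat) : forall X Y, chain H p X Y -> chain H' p (o X) (o Y) :=
  match p with
  | 0 => fun X Y s => h s
  | p'.+1 => fun X Y s =>
      existT _ (o (projT1 s)) (h (projT2 s).1, cmap (projT2 s).2)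
  end.

Lemma unsnoc_map p X Y (s : chain H p.+1 X Y) :
  unsnoc (cmap s) =
  existT (fun Z => (chain H' p Z (o Y) * H' (o X) Z)%type) (o (projT1 (unsnoc s)))
    (cmap (projT2 (unsnoc s)).1, h (projT2 (unsnoc s)).2).
Proof. by elim: p X Y s => [|p IHp] X Y [Z [f r]] //=; rewrite IHp. Qed.

Variables (c : forall X Y Z, H Y Z -> H X Y -> H X Z).
Variables (c' : forall X Y Z, H' Y Z -> H' X Y -> H' X Z).

Lemma ccomp_map p X Y (s : chain H p X Y) :
  (forall X Y Z (g : H Y Z) (f : H X Y), h (c g f) = c' (h g) (h f)) ->
  ccomp c' (cmap s) = h (ccomp c s).
Proof. by move=> hM; elim: p X Y s => [|p IHp] X Y //= s; rewrite IHp hM. Qed.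

End Map.
End Chains.

(* (q+1)-tuples, i.e. the (q+1)-st power of the 2-category.
   Below p = m - 1 and q = n - 1, so that [cochain p q] is X^{p,q}; entries of
   a tuple are numbered from 0. *)
Section Tuples.
Variables (K : comPzRingType) (D : gray_data K).

Fixpoint obs (q : nat) : Type := if q is q'.+1 then (Ob D * obs q')%type else Ob D.

Fixpoint homs (q : nat) : obs q -> obs q -> Type :=
  match q with
  | 0 => fun X Y => Hom X Y
  | q'.+1 => fun X Y => (Hom X.1 Y.1 * homs X.2 Y.2)%type
  end.

Fixpoint homs2 (q : nat) : forall X Y : obs q, homs X Y -> homs X Y -> Type :=
  match q with
  | 0 => fun X Y f g => Hom2 f g
  | q'.+1 => fun X Y f g => (Hom2 f.1 g.1 * homs2 f.2 g.2)%type
  end.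

Fixpoint ids (q : nat) : forall X : obs q, homs X X :=
  match q with
  | 0 => fun X => id1 X
  | q'.+1 => fun X => (id1 X.1, ids X.2)
  end.

Variant is_ids (q : nat) (X : obs q) : forall Y, homs X Y -> Prop :=
  IsIds : is_ids (ids X).

Fixpoint comps (q : nat) :
    forall X Y Z : obs q, homs Y Z -> homs X Y -> homs X Z :=
  match q with
  | 0 => fun X Y Z g f => g ∘ f
  | q'.+1 => fun X Y Z g f => (g.1 ∘ f.1, comps g.2 f.2)
  end.

Fixpoint hcomps (q : nat) : forall (X Y Z : obs q) (g g' : homs Y Z)
    (f f' : homs X Y), homs2 g g' -> homs2 f f' -> homs2 (comps g f) (comps g' f') :=
  match q with
  | 0 => fun X Y Z g g' f f' t s => t ⊙ s
  | q'.+1 => fun X Y Z g g' f f' t s => (t.1 ⊙ s.1, hcomps t.2 s.2)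
  end.

Fixpoint Tob (q : nat) : obs q -> Ob D :=
  match q with
  | 0 => fun X => X
  | q'.+1 => fun X => tob X.1 (Tob X.2)
  end.

Fixpoint T (q : nat) : forall X Y : obs q, homs X Y -> Hom (Tob X) (Tob Y) :=
  match q with
  | 0 => fun X Y f => f
  | q'.+1 => fun X Y f => f.1 ⊗ T f.2
  end.

Fixpoint T2 (q : nat) :
    forall (X Y : obs q) (f g : homs X Y), homs2 f g -> Hom2 (T f) (T g) :=
  match q with
  | 0 => fun X Y f g t => t
  | q'.+1 => fun X Y f g t => t.1 ⊠ T2 t.2
  end.

(* (x_0, ..., x_i ⊗ x_(i+1), ..., x_(q+1)) *)
Fixpoint tmergeO (q i : nat) : obs q.+1 -> obs q :=
  match q with
  | 0 => fun X => tob X.1 X.2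
  | q'.+1 => match i with
    | 0 => fun X => (tob X.1 X.2.1, X.2.2)
    | i'.+1 => fun X => (X.1, tmergeO i' X.2)
    end
  end.

Fixpoint tmerge (q i : nat) : forall X Y : obs q.+1,
    homs X Y -> homs (tmergeO i X) (tmergeO i Y) :=
  match q with
  | 0 => fun X Y f => f.1 ⊗ f.2
  | q'.+1 => match i with
    | 0 => fun X Y f => (f.1 ⊗ f.2.1, f.2.2)
    | i'.+1 => fun X Y f => (f.1, tmerge i' f.2)
    end
  end.

Fixpoint olast (q : nat) : obs q -> Ob D :=
  match q with 0 => fun X => X | q'.+1 => fun X => olast X.2 end.
Fixpoint tlast (q : nat) : forall X Y : obs q, homs X Y -> Hom (olast X) (olast Y) :=
  match q with 0 => fun X Y f => f | q'.+1 => fun X Y f => tlast f.2 end.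

Fixpoint obelast (q : nat) : obs q.+1 -> obs q :=
  match q with 0 => fun X => X.1 | q'.+1 => fun X => (X.1, obelast X.2) end.
Fixpoint tbelast (q : nat) :
    forall X Y : obs q.+1, homs X Y -> homs (obelast X) (obelast Y) :=
  match q with
  | 0 => fun X Y f => f.1
  | q'.+1 => fun X Y f => (f.1, tbelast f.2)
  end.

Definition thead (q : nat) (X Y : obs q.+1) (f : homs X Y) : Hom X.1 Y.1 := f.1.
Definition tbehead (q : nat) (X Y : obs q.+1) (f : homs X Y) : homs X.2 Y.2 := f.2.

Definition path1 := chain (@Hom K D).
Definition pathn (q : nat) := chain (@homs q).

Definition pcomp p X Y (s : path1 p X Y) : Hom X Y := ccomp (@comp K D) s.
(* the componentwise composite (c^1, ..., c^n) *)
Definition rcomp q p (X Y : obs q) (s : pathn p X Y) : homs X Y :=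
  ccomp (@comps q) s.

(* T_0 ∘ ... ∘ T_p *)
Definition Tcomp q p (X Y : obs q) (s : pathn p X Y) : Hom (Tob X) (Tob Y) :=
  pcomp (cmap (@T q) s).

Definition cochain (p q : nat) : Type :=
  forall (X Y : obs q) (s : pathn p X Y), Hom2 (Tcomp s) (T (rcomp s)).

Definition cochain0 (p q : nat) (phi : cochain p q) : Prop :=
  forall X Y (s : pathn p X Y), phi X Y s = 0.

(* [pathn2]: composable sequences of tuples of 2-cells. *)
Definition rowcell (q : nat) (X Y : obs q) := {f : homs X Y & {g & homs2 f g}}.
Definition pathn2 (q : nat) := chain (@rowcell q).
Definition rowsrc q (X Y : obs q) (t : rowcell X Y) : homs X Y := projT1 t.
Definition rowtgt q (X Y : obs q) (t : rowcell X Y) : homs X Y :=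
  projT1 (projT2 t).
Definition psrc q p (X Y : obs q) (t : pathn2 p X Y) : pathn p X Y :=
  cmap (o := id) (@rowsrc q) t.
Definition ptgt q p (X Y : obs q) (t : pathn2 p X Y) : pathn p X Y :=
  cmap (o := id) (@rowtgt q) t.

Fixpoint Tcomp2 (q p : nat) : forall (X Y : obs q) (t : pathn2 p X Y),
    Hom2 (Tcomp (psrc t)) (Tcomp (ptgt t)) :=
  match p with
  | 0 => fun X Y t => T2 (projT2 (projT2 t))
  | p'.+1 => fun X Y t =>
      T2 (projT2 (projT2 (projT2 t).1)) ⊙ Tcomp2 (projT2 t).2
  end.

Fixpoint rcomp2 (q p : nat) : forall (X Y : obs q) (t : pathn2 p X Y),
    homs2 (rcomp (psrc t)) (rcomp (ptgt t)) :=
  match p with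
  | 0 => fun X Y t => projT2 (projT2 t)
  | p'.+1 => fun X Y t =>
      hcomps (projT2 (projT2 (projT2 t).1)) (rcomp2 (projT2 t).2)
  end.

Definition natural (p q : nat) (phi : cochain p q) : Prop :=
  forall X Y (t : pathn2 p X Y),
    phi X Y (ptgt t) ∙ Tcomp2 t = T2 (rcomp2 t) ∙ phi X Y (psrc t).

Fixpoint some_ids (q p : nat) : forall X Y : obs q, pathn p X Y -> Prop :=
  match p with
  | 0 => fun X Y s => is_ids s
  | p'.+1 => fun X Y s => is_ids (projT2 s).1 \/ some_ids (projT2 s).2
  end.

Definition special (p q : nat) (phi : cochain p q) : Prop :=
  forall X Y (s : pathn p X Y), some_ids s -> phi X Y s = 0.

(* Θ_2 of a sequence of pairs, given as two sequences of equal length. *)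
Fixpoint pathT (p : nat) : forall X Y X' Y',
    path1 p X Y -> path1 p X' Y' -> path1 p (tob X X') (tob Y Y') :=
  match p with
  | 0 => fun X Y X' Y' s s' => tens s s'
  | p'.+1 => fun X Y X' Y' s s' =>
      existT _ (tob (projT1 s) (projT1 s'))
        ((projT2 s).1 ⊗ (projT2 s').1, pathT (projT2 s).2 (projT2 s').2)
  end.

Fixpoint Theta2 (p : nat) :
    forall X Y X' Y' (s : path1 p X Y) (s' : path1 p X' Y'),
      Hom2 (pcomp (pathT s s')) (pcomp s ⊗ pcomp s') :=
  match p with
  | 0 => fun X Y X' Y' s s' => id2 (s ⊗ s' : Hom (tob X X') (tob Y Y'))
  | p'.+1 => fun X Y X' Y' s s' =>
      let f := (projT2 s).1 in let r := (projT2 s).2 in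
      let g := (projT2 s').1 in let r' := (projT2 s').2 in
      hatT f g (pcomp r) (pcomp r') ∙ (id2 (f ⊗ g) ⊙ Theta2 r r')
  end.

(* Θ_n of a sequence (f, g) of length two, the only case used below. *)
Fixpoint Theta (q : nat) : forall (X Y Z : obs q) (f : homs Y Z) (g : homs X Y),
    Hom2 (T f ∘ T g) (T (comps f g)) :=
  match q with
  | 0 => fun X Y Z f g => id2 (f ∘ g)
  | q'.+1 => fun X Y Z f g =>
      (id2 (f.1 ∘ g.1) ⊠ Theta f.2 g.2) ∙ hatT f.1 (T f.2) g.1 (T g.2)
  end.

End Tuples.

Section DoubleComplex.
Variables (K : comPzRingType) (C : graySemigroup K).
Implicit Types p q i n : nat.

Lemma compsA q (X Y Z W : obs C q) (h : homs Z W) (g : homs Y Z) (f : homs X Y) :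
  comps h (comps g f) = comps (comps h g) f.
Proof.
elim: q X Y Z W h g f => [|q IHq] X Y Z W h g f /=.
  exact: compA (gray_2category C) _ _ _ _ h g f.
by rewrite IHq (compA (gray_2category C)).
Qed.

Definition merge_rows q p i (X Y : obs C q) (s : pathn p.+1 X Y) : pathn p X Y :=
  cmerge (@comps K C q) i s.
Definition pmid q p (X Y : obs C q) (s : pathn p.+1 X Y) : obs C q :=
  projT1 (unsnoc s).
Definition pinit q p (X Y : obs C q) (s : pathn p.+1 X Y) : pathn p (pmid s) Y :=
  (projT2 (unsnoc s)).1.
Definition plast q p (X Y : obs C q) (s : pathn p.+1 X Y) : homs X (pmid s) :=
  (projT2 (unsnoc s)).2.

Lemma hmid_src q p (X Y : obs C q) (s : pathn p.+2 X Y) :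
  Arr ((T (projT2 s).1 ∘ T (projT2 (projT2 s).2).1) ∘ Tcomp (projT2 (projT2 s).2).2)
  = Arr (Tcomp s).
Proof. by rewrite -(compA (gray_2category C)). Qed.

(* 1 ∘ Θ_n(f_i, f_(i+1)) ∘ 1 *)
Fixpoint hmid q p i : forall (X Y : obs C q) (s : pathn p.+1 X Y),
    Hom2 (Tcomp s) (Tcomp (merge_rows i s)) :=
  match p with
  | 0 => fun X Y s => Theta (projT2 s).1 (projT2 s).2
  | p'.+1 => match i with
    | 0 => fun X Y s =>
        let f0 := (projT2 s).1 in
        let f1 := (projT2 (projT2 s).2).1 in
        let r := (projT2 (projT2 s).2).2 in
        cast (hmid_src s) erefl (Theta f0 f1 ⊙ id2 (Tcomp r))
    | i'.+1 => fun X Y s => id2 (T (projT2 s).1) ⊙ hmid i' (projT2 s).2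
    end
  end.

Lemma rcomp_merge_rows q p i (X Y : obs C q) (s : pathn p.+1 X Y) :
  Arr (T (rcomp (merge_rows i s))) = Arr (T (rcomp s)).
Proof. by rewrite /rcomp ccomp_merge //; apply: compsA. Qed.

Lemma Tcomp_unsnoc q p (X Y : obs C q) (s : pathn p.+1 X Y) :
  Arr (Tcomp (pinit s) ∘ T (plast s)) = Arr (Tcomp s).
Proof.
have := ccomp_unsnoc (compA (gray_2category C)) (cmap (@T K C q) s).
by rewrite unsnoc_map /= => e; congr (Arr _).
Qed.

Lemma rcomp_unsnoc q p (X Y : obs C q) (s : pathn p.+1 X Y) :
  Arr (T (comps (rcomp (pinit s)) (plast s))) = Arr (T (rcomp s)).
Proof. by congr (Arr (T _)); apply: ccomp_unsnoc; apply: compsA. Qed.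

Definition delta_h p q (phi : cochain C p q) : cochain C p.+1 q :=
  fun X Y s =>
    let f0 := (projT2 s).1 in
    let r := (projT2 s).2 in
    Theta f0 (rcomp r) ∙ (id2 (T f0) ⊙ phi _ _ r)
    + \sum_(i < p.+1) (-1) ^+ i.+1 *:
        cast erefl (rcomp_merge_rows i s) (phi _ _ (merge_rows i s) ∙ hmid i s)
    + (-1) ^+ p.+2 *:
        cast (Tcomp_unsnoc s) (rcomp_unsnoc s)
          (Theta (rcomp (pinit s)) (plast s)
           ∙ (phi _ _ (pinit s) ⊙ id2 (T (plast s)))).

(* The column (f_0^0, ..., f_p^0), and the rows with their first entry, resp.
   last entry, removed, or with the entries i and i+1 tensored. *)
Definition phead q p (X Y : obs C q.+1) (s : pathn p X Y) : path1 p X.1 Y.1 :=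
  cmap (o := fst) (@thead K C q) s.
Definition pbehead q p (X Y : obs C q.+1) (s : pathn p X Y) : pathn p X.2 Y.2 :=
  cmap (o := snd) (@tbehead K C q) s.
Definition plastcol q p (X Y : obs C q) (s : pathn p X Y) :
    path1 p (olast X) (olast Y) :=
  cmap (@tlast K C q) s.
Definition pbelast q p (X Y : obs C q.+1) (s : pathn p X Y) :
    pathn p (obelast X) (obelast Y) :=
  cmap (@tbelast K C q) s.
Definition ptmerge q p i (X Y : obs C q.+1) (s : pathn p X Y) :
    pathn p (tmergeO i X) (tmergeO i Y) :=
  cmap (@tmerge K C q i) s.
Definition pT q p (X Y : obs C q) (s : pathn p X Y) : path1 p (Tob X) (Tob Y) :=
  cmap (@T K C q) s.

Lemma pcomp_phead q p (X Y : obs C q.+1) (s : pathn p X Y) :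
  pcomp (phead s) = (rcomp s).1.
Proof. exact: (ccomp_map (o := fst) (c := @comps K C q.+1)). Qed.

Lemma rcomp_pbehead q p (X Y : obs C q.+1) (s : pathn p X Y) :
  rcomp (pbehead s) = (rcomp s).2.
Proof. exact: (ccomp_map (o := snd) (c := @comps K C q.+1)). Qed.

Lemma vfirst_src q p (X Y : obs C q.+1) (s : pathn p X Y) :
  Arr (pcomp (pathT (phead s) (pT (pbehead s)))) = Arr (Tcomp s).
Proof.
by elim: p X Y s => [|p IHp] X Y s //=; apply: Arr_comp => //; apply: IHp.
Qed.

Lemma vfirst_tgt q p (X Y : obs C q.+1) (s : pathn p X Y) :
  Arr (pcomp (phead s) ⊗ T (rcomp (pbehead s))) = Arr (T (rcomp s)).
Proof. by rewrite pcomp_phead rcomp_pbehead. Qed.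

Lemma T_belast q (X Y : obs C q.+1) (f : homs X Y) :
  Arr (T (tbelast f) ⊗ tlast f) = Arr (T f).
Proof.
elim: q X Y f => [|q IHq] X Y f //=.
rewrite -(tensA (gray_gray C)); apply: Arr_tens => //; exact: IHq.
Qed.

Lemma vlast_src q p (X Y : obs C q.+1) (s : pathn p X Y) :
  Arr (pcomp (pathT (pT (pbelast s)) (plastcol s))) = Arr (Tcomp s).
Proof.
elim: p X Y s => [|p IHp] X Y s /=; first exact: T_belast.
by apply: Arr_comp; [exact: T_belast | exact: IHp].
Qed.

Lemma vlast_tgt q p (X Y : obs C q.+1) (s : pathn p X Y) :
  Arr (T (rcomp (pbelast s)) ⊗ pcomp (plastcol s)) = Arr (T (rcomp s)).
Proof.
rewrite -T_belast /rcomp /pcomp.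
rewrite (ccomp_map (c := @comps K C q.+1) (c' := @comps K C q)); last first.
  by elim: (q) => [|k IHk] //= *; rewrite IHk.
rewrite (ccomp_map (c := @comps K C q.+1) (c' := @comp K C)) //.
by elim: (q.+1) => [|k IHk] //= *; rewrite IHk.
Qed.

Record twocell (X Y : Ob C) := TwoCell {
  tsrc : Hom X Y;
  ttgt : Hom X Y;
  tcell : Hom2 tsrc ttgt
}.

(* 1 ⊗ Θ_2(column i, column i+1) ⊗ 1 *)
Fixpoint vslot q p i : forall (X Y : obs C q.+1) (s : pathn p X Y),
    twocell (Tob (tmergeO i X)) (Tob (tmergeO i Y)) :=
  match q with
  | 0 => fun X Y s => TwoCell (Theta2 (phead s) (pbehead s))
  | q'.+1 => match i with
    | 0 => fun X Y s =>
        TwoCell (Theta2 (phead s) (phead (pbehead s))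
                 ⊠ id2 (T (rcomp (pbehead (pbehead s)))))
    | i'.+1 => fun X Y s =>
        TwoCell (id2 (pcomp (phead s)) ⊠ tcell (vslot i' (pbehead s)))
    end
  end.

Lemma vslot_src q p i (X Y : obs C q.+1) (s : pathn p X Y) :
  Arr (T (rcomp (ptmerge i s))) = Arr (tsrc (vslot i s)).
Proof.
elim: q p i X Y s => [|q IHq] p [|i] X Y s.
- by congr (Arr _); elim: p X Y s => [|p IHp] X Y s //=; congr (_ ∘ _); apply: IHp.
- by congr (Arr _); elim: p X Y s => [|p IHp] X Y s //=; congr (_ ∘ _); apply: IHp.
- suff -> : rcomp (ptmerge 0 s) =
      (pcomp (pathT (phead s) (phead (pbehead s))), rcomp (pbehead (pbehead s))) by [].
  elim: p X Y s => [|p IHp] X Y s //=.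
  by have := IHp _ _ (projT2 s).2; rewrite /rcomp /ptmerge => ->.
suff -> : rcomp (ptmerge i.+1 s) = (pcomp (phead s), rcomp (ptmerge i (pbehead s))).
  by apply: Arr_tens; [| exact: IHq].
elim: p X Y s => [|p IHp] X Y s //=.
by have := IHp _ _ (projT2 s).2; rewrite /rcomp /ptmerge => ->.
Qed.

Lemma vslot_tgt q p i (X Y : obs C q.+1) (s : pathn p X Y) :
  Arr (ttgt (vslot i s)) = Arr (T (rcomp s)).
Proof.
elim: q i X Y s => [|q IHq] [|i] X Y s; [exact: (@vfirst_tgt 0) | exact: (@vfirst_tgt 0) | |].
  rewrite -vfirst_tgt -(tensA (gray_gray C)).
  by apply: Arr_tens; [| exact: vfirst_tgt].
rewrite -vfirst_tgt; apply: Arr_tens; [by [] | exact: IHq].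
Qed.

Lemma T_tmerge q i (X Y : obs C q.+1) (f : homs X Y) :
  Arr (T (tmerge i f)) = Arr (T f).
Proof.
elim: q i X Y f => [|q IHq] [|i] X Y f //=.
  by rewrite -(tensA (gray_gray C)).
by apply: Arr_tens => //; exact: IHq.
Qed.

Lemma Tcomp_ptmerge q p i (X Y : obs C q.+1) (s : pathn p X Y) :
  Arr (Tcomp (ptmerge i s)) = Arr (Tcomp s).
Proof.
elim: p X Y s => [|p IHp] X Y s /=; first exact: T_tmerge.
by apply: Arr_comp; [exact: T_tmerge | exact: IHp].
Qed.

Definition delta_v p q (phi : cochain C p q) : cochain C p q.+1 :=
  fun X Y s =>
    cast (vfirst_src s) (vfirst_tgt s)
      ((id2 (pcomp (phead s)) ⊠ phi _ _ (pbehead s))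
       ∙ Theta2 (phead s) (pT (pbehead s)))
    + \sum_(i < q.+1) (-1) ^+ i.+1 *:
        cast (Tcomp_ptmerge i s) (vslot_tgt i s)
          (tcell (vslot i s)
           ∙ cast erefl (vslot_src i s) (phi _ _ (ptmerge i s)))
    + (-1) ^+ q.+2 *:
        cast (vlast_src s) (vlast_tgt s)
          ((phi _ _ (pbelast s) ⊠ id2 (pcomp (plastcol s)))
           ∙ Theta2 (pT (pbelast s)) (plastcol s)).

(* X^n_ass, for a cochain in X^{0,n}. *)
Definition in_Xass n (phi : cochain C 0 n) : Prop :=
  [/\ natural phi, special phi & cochain0 (delta_h phi)].

Record cocycle n := Cocycle {
  cocycle_val : cochain C 0 n;
  cocycle_Xass : in_Xass cocycle_val;
  cocycleP : cochain0 (delta_v cocycle_val)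
}.

Definition is_coboundary n : cochain C 0 n -> Prop :=
  match n with
  | 0 => fun phi => cochain0 phi
  | n'.+1 => fun phi => exists2 psi : cochain C 0 n', in_Xass psi &
      forall X Y (s : pathn 0 X Y), phi X Y s = delta_v psi s
  end.

Definition cohomologous n (z z' : cocycle n) : Prop :=
  is_coboundary (fun X Y s => cocycle_val z' s - cocycle_val z s).

End DoubleComplex.

(* The set of classes of an equivalence relation [R]. *)
Definition classes (A : Type) (R : A -> A -> Prop) : Type :=
  {P : A -> Prop | exists x, P = R x}.

Definition H_ass (K : comPzRingType) (C : graySemigroup K) (n : nat) : Type :=
  classes (@cohomologous K C n).

(* Main.v *)
(* Writing the associator as 1 + a ε and expanding with ε² = 0, every axiom
   becomes linear in a: naturality is naturality of the cochain a, the unit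
   condition says that a is special, compatibility with composition is
   δ_h a = 0, and the pentagon is δ_v a = 0; the order-zero parts are the axioms
   of the Gray semigroup itself.  In the same way a ψ-equivalence 1 + ψ ε from a
   to a' is an element ψ of X^1_ass with δ_v ψ = a' - a.  Thus deformations are
   the same as 2-cocycles, and ψ-equivalence is cohomology. *)

From mathcomp Require Import all_boot all_algebra.
From Stdlib Require Import Eqdep FunctionalExtensionality PropExtensionality.
From Stdlib Require Import ProofIrrelevance.
Require Import Defs.

Set Implicit Arguments.
Unset Strict Implicit.
Unset Printing Implicit Defensive.

Import GRing.Theory.
Local Open Scope ring_scope.
Local Open Scope gray_scope.

(** * Transport of 2-cells along strict equalities of their boundaries *)

Section Cells.
Variables (K : comPzRingType) (D : gray_data K).
Implicit Types X Y Z U V W : Ob D.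

(** By [inj_pair2], packing over a fixed boundary loses nothing. Equations between transported
    2-cells can thus be checked on packed cells, where [cell_cast] erases every cast. *)
Lemma cell_inj X Y (f g : Hom X Y) (t u : Hom2 f g) : cell t = cell u -> t = u.
Proof. exact: inj_pair2. Qed.

Lemma cell_cast X Y (f g : Hom X Y) X' Y' (f' g' : Hom X' Y')
    (ef : Arr f = Arr f') (eg : Arr g = Arr g') (t : Hom2 f g) :
  cell (cast ef eg t) = cell t.
Proof.
rewrite /cast /cell.
by case: (Bd f' g') / (Bd_eq ef eg).
Qed.

Lemma cast_id X Y (f g : Hom X Y) (ef : Arr f = Arr f) (eg : Arr g = Arr g)
    (t : Hom2 f g) : cast ef eg t = t.
Proof. by apply: cell_inj; rewrite cell_cast. Qed.

(** The 1-cells share their endpoints, so both equalities are eliminated together, as the single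
    equality of boundaries given by [Bd_eq]. *)
Lemma Arr_rect X Y (f g : Hom X Y)
    (P : forall X' Y', Hom X' Y' -> Hom X' Y' -> Prop) :
  P X Y f g ->
  forall X' Y' (f' g' : Hom X' Y'), Arr f = Arr f' -> Arr g = Arr g' ->
    P X' Y' f' g'.
Proof.
move=> Pfg X' Y' f' g' ef eg.
pose Q (b : boundary D) :=
  P (projT1 b).1 (projT1 b).2 (projT2 b).1 (projT2 b).2.
by have : Q (Bd f g) by []; rewrite (Bd_eq ef eg).
Qed.

Lemma castI X Y (f g : Hom X Y) X' Y' (f' g' : Hom X' Y')
    (ef ef' : Arr f = Arr f') (eg eg' : Arr g = Arr g') (t : Hom2 f g) :
  cast ef eg t = cast ef' eg' t.
Proof. by apply: cell_inj; rewrite !cell_cast. Qed.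

Lemma cell_rect X Y (f g : Hom X Y) (t : Hom2 f g)
    (P : forall X' Y' (f' g' : Hom X' Y'), Hom2 f' g' -> Prop) :
  P X Y f g t ->
  forall X' Y' (f' g' : Hom X' Y') (t' : Hom2 f' g'),
    cell t = cell t' -> P X' Y' f' g' t'.
Proof.
move=> Pt X' Y' f' g' t' e.
pose Q (c : {b : boundary D & cell_of b}) :=
  P (projT1 (projT1 c)).1 (projT1 (projT1 c)).2
    (projT2 (projT1 c)).1 (projT2 (projT1 c)).2 (projT2 c).
by have : Q (cell t) by []; rewrite e.
Qed.

Lemma cell_id2 X Y (f : Hom X Y) X' Y' (f' : Hom X' Y') :
  Arr f = Arr f' -> cell (id2 f) = cell (id2 f').
Proof.
pose F (a : arr D) := cell (id2 (projT2 a)).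
by move=> e; have := congr1 F e.
Qed.

Lemma cell_tens2 X X' Y Y' (f f' : Hom X X') (g g' : Hom Y Y')
    U U' V V' (h h' : Hom U U') (k k' : Hom V V')
    (t : Hom2 f f') (s : Hom2 g g') (t' : Hom2 h h') (s' : Hom2 k k') :
  cell t = cell t' -> cell s = cell s' -> cell (t ⊠ s) = cell (t' ⊠ s').
Proof.
move=> et es.
apply: (cell_rect (P := fun _ _ _ _ t' => _ = cell (t' ⊠ s')) _ et).
by apply: (cell_rect (P := fun _ _ _ _ s' => _ = cell (t ⊠ s')) _ es).
Qed.

End Cells.

(** The ε-coefficient of [psi_assoc] arrives in the left form, with [a] and [b] the two associators;
    the right form is the coboundary equation. *)
Lemma addr_subr_swap (V : zmodType) (a b u v : V) :
  u + a = b + v <-> b - a = u - v.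
Proof.
have swap : (u + a == b + v) = (b - a == u - v).
  by rewrite subr_eq addrAC [RHS]eq_sym subr_eq.
by split=> /eqP e; apply/eqP; rewrite ?swap // -swap.
Qed.

Lemma linear_fun0 (K : comPzRingType) (V W : lmodType K) (f : V -> W) :
  linear f -> f 0 = 0.
Proof.
(* Linearity at [-1], [0], [0] reads [f 0 = - f 0 + f 0]. *)
by move=> lf; have := lf (-1) 0 0; rewrite scaler0 addr0 scaleN1r addNr.
Qed.

(** * First-order arithmetic with the 2-cells 1 + a ε *)

Section Dual.
Variables (K : comPzRingType) (C : graySemigroup K).
Implicit Types X Y Z U V W : Ob C.

Let C2 := gray_2category C.
Let CK := gray_klinear C.
Let CG := gray_gray C.

Lemma vcompt0 X Y (f g h : Hom X Y) (t : Hom2 g h) : t ∙ (0 : Hom2 f g) = 0.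
Proof. exact: linear_fun0 (vcomp_linr CK t). Qed.

Lemma vcomp0t X Y (f g h : Hom X Y) (s : Hom2 f g) : (0 : Hom2 g h) ∙ s = 0.
Proof. exact: (linear_fun0 (vcomp_linl CK s)). Qed.

Lemma hcompt0 X Y Z (g g' : Hom Y Z) (f f' : Hom X Y) (t : Hom2 g g') :
  t ⊙ (0 : Hom2 f f') = 0.
Proof. exact: (linear_fun0 (hcomp_linr CK t)). Qed.

Lemma hcomp0t X Y Z (g g' : Hom Y Z) (f f' : Hom X Y) (s : Hom2 f f') :
  (0 : Hom2 g g') ⊙ s = 0.
Proof. exact: (linear_fun0 (hcomp_linl CK s)). Qed.

Lemma tens2t0 X X' Y Y' (f f' : Hom X X') (g g' : Hom Y Y') (t : Hom2 f f') :
  t ⊠ (0 : Hom2 g g') = 0.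
Proof. exact: (linear_fun0 (tens2_linr CK t)). Qed.

Lemma tens20t X X' Y Y' (f f' : Hom X X') (g g' : Hom Y Y') (s : Hom2 g g') :
  (0 : Hom2 f f') ⊠ s = 0.
Proof. exact: (linear_fun0 (tens2_linl CK s)). Qed.

(* [deform a] is 1 + a ε and [const t] is t + 0 ε. *)
Definition deform X Y (f : Hom X Y) (a : Hom2 f f) : @Hom2 K (dual C) X Y f f :=
  eps_cell (id2 f) a.
Definition const X Y (f g : Hom X Y) (t : Hom2 f g) :
  @Hom2 K (dual C) X Y f g := eps_cell t 0.

Lemma deform_inj X Y (f : Hom X Y) (a b : Hom2 f f) :
  deform a = deform b -> a = b.
Proof. by case. Qed.

(** The cross term carries ε² = 0. This is what turns vertical composites in the deformation axioms
    into sums. *)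
Lemma deform_vcomp X Y (f : Hom X Y) (a b : Hom2 f f) :
  vcomp (deform a) (deform b) = deform (a + b).
Proof.
by congr pair; rewrite /= ?(vcomp1t C2) // (vcompt1 C2) addrC.
Qed.

(** The inverse is 1 - a ε, so invertibility puts no condition on [a]. *)
Lemma deform_iso X Y (f : Hom X Y) (a : Hom2 f f) : iso2 (deform a).
Proof.
by exists (deform (- a)); rewrite !deform_vcomp subrr addNr.
Qed.

Lemma deform_const X Y (f g : Hom X Y) (a : Hom2 g g) (t : Hom2 f g) :
  vcomp (deform a) (const t) = eps_cell t (a ∙ t).
Proof.
by congr pair; rewrite /= (vcomp1t C2) ?add0r.
Qed.

Lemma const_deform X Y (f g : Hom X Y) (t : Hom2 f g) (a : Hom2 f f) :
  vcomp (const t) (deform a) = eps_cell t (t ∙ a).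
Proof.
by congr pair; rewrite /= ?(vcompt1 C2) // addr0.
Qed.

Lemma const_vcomp X Y (f g h : Hom X Y) (t : Hom2 g h) (s : Hom2 f g) :
  vcomp (const t) (const s) = const (t ∙ s).
Proof.
by congr pair; rewrite /= vcompt0 vcomp0t addr0.
Qed.

Lemma const_tens2 X X' Y Y' (f f' : Hom X X') (g g' : Hom Y Y')
    (t : Hom2 f f') (s : Hom2 g g') :
  tens2 (const t) (const s) = const (t ⊠ s).
Proof.
by congr pair; rewrite /= tens2t0 tens20t addr0.
Qed.

Lemma deform_tens2l X X' Y Y' (f : Hom X X') (g : Hom Y Y') (a : Hom2 g g) :
  tens2 (@id2 K (dual C) _ _ f) (deform a) = deform (id2 f ⊠ a).
Proof.
congr pair; rewrite /= ?(tens2_id2 CG) //.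
by rewrite tens20t addr0.
Qed.

Lemma deform_tens2r X X' Y Y' (f : Hom X X') (g : Hom Y Y') (a : Hom2 f f) :
  tens2 (deform a) (@id2 K (dual C) _ _ g) = deform (a ⊠ id2 g).
Proof.
congr pair; rewrite /= ?(tens2_id2 CG) //.
by rewrite tens2t0 add0r.
Qed.

Lemma deform_hcompl X Y Z (g : Hom Y Z) (f : Hom X Y) (a : Hom2 f f) :
  hcomp (@id2 K (dual C) _ _ g) (deform a) = deform (id2 g ⊙ a).
Proof.
congr pair; rewrite /= ?(hcomp_id2 C2) //.
by rewrite hcomp0t addr0.
Qed.

Lemma deform_hcompr X Y Z (g : Hom Y Z) (f : Hom X Y) (a : Hom2 g g) :
  hcomp (deform a) (@id2 K (dual C) _ _ f) = deform (a ⊙ id2 f).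
Proof.
congr pair; rewrite /= ?(hcomp_id2 C2) //.
by rewrite hcompt0 add0r.
Qed.

(** [dual] keeps objects and 1-cells, so equalities of packed 1-cells of [C] serve unchanged in
    [dual C]. *)
Lemma cast_dual X Y (f g : Hom X Y) X' Y' (f' g' : Hom X' Y')
    (ef : Arr f = Arr f') (eg : Arr g = Arr g') (t : @Hom2 K (dual C) X Y f g) :
  @cast K (dual C) X Y f g X' Y' f' g' ef eg t
  = eps_cell (cast ef eg t.1) (cast ef eg t.2).
Proof.
move: (ef) (eg).
apply: (Arr_rect (P := fun _ _ f' g' =>
    forall (ef : Arr f = Arr f') (eg : Arr g = Arr g'),
      @cast K (dual C) X Y f g _ _ f' g' ef eg t
      = eps_cell (cast ef eg t.1) (cast ef eg t.2)) _ ef eg) => e1 e2.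
by rewrite !cast_id; case: t.
Qed.

Lemma cast_const X Y (f g : Hom X Y) X' Y' (f' g' : Hom X' Y')
    (ef : Arr f = Arr f') (eg : Arr g = Arr g') (t : Hom2 f g) :
  @cast K (dual C) X Y f g X' Y' f' g' ef eg (const t) = const (cast ef eg t).
Proof.
rewrite cast_dual; congr pair => /=.
move: (ef) (eg).
apply: (Arr_rect (P := fun _ _ f' g' =>
    forall (ef : Arr f = Arr f') (eg : Arr g = Arr g'),
      @cast K C _ _ f g _ _ f' g' ef eg 0 = 0) _ ef eg) => e1 e2.
exact: cast_id.
Qed.

Lemma cast_deform X Y (f : Hom X Y) X' Y' (f' : Hom X' Y')
    (e e' : Arr f = Arr f') (a : Hom2 f f) :
  @cast K (dual C) X Y f f X' Y' f' f' e e' (deform a) = deform (cast e e' a).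
Proof.
rewrite cast_dual; congr pair.
by apply: cell_inj; rewrite cell_cast; apply: cell_id2.
Qed.

(** The first-order part of [t] contributes the same summand [t.2] to both sides and cancels. *)
Lemma deform_naturalE X Y (f g : Hom X Y) (a : Hom2 f f) (b : Hom2 g g)
    (t : @Hom2 K (dual C) X Y f g) :
  vcomp (deform b) t = vcomp t (deform a) <-> b ∙ t.1 = t.1 ∙ a.
Proof.
case: t => t0 t1; rewrite /deform /eps_cell /=.
rewrite !(vcomp1t C2) !(vcompt1 C2) addrC; split=> [[/addIr] | ->] //.
Qed.

(** Order zero reads [t = t]. The ε-coefficient is arranged in the order and with the signs of
    [delta_h] on a sequence of length two, with Θ in the place of [t]. *)
Lemma deform_compE X Y (f g : Hom X Y) (a : Hom2 g g) (b c : Hom2 f f)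
    (t : Hom2 f g) :
  vcomp (deform a) (const t) = vcomp (vcomp (const t) (deform b)) (deform c)
  <-> t ∙ c - a ∙ t + t ∙ b = 0.
Proof.
rewrite deform_const const_deform /deform /eps_cell /= (vcompt1 C2).
rewrite (vcompt1 C2) addrAC.
by split=> [[->] | /subr0_eq ->] //; rewrite subrr.
Qed.

End Dual.

(** * The row p = 0 of the double complex: cochains on single tuples *)

Section ZeroRow.
Variables (K : comPzRingType) (C : graySemigroup K).
Implicit Types q i : nat.

Let C2 := gray_2category C.
Let CG := gray_gray C.

Lemma natural0E q (phi : cochain C 0 q) :
  natural phi <-> forall X Y (f g : homs X Y) (t : homs2 f g),
    phi X Y g ∙ T2 t = T2 t ∙ phi X Y f.
Proof.
split=> [nphi X Y f g t | nphi X Y [f [g t]]]; last exact: nphi.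
exact: (nphi X Y (existT _ f (existT _ g t))).
Qed.

Lemma special0E q (phi : cochain C 0 q) :
  special phi <-> forall X, phi X X (ids X) = 0.
Proof.
split=> [sphi X | sphi X Y s]; first by apply: sphi.
by move=> ids_s; case: Y s / ids_s; apply: sphi.
Qed.

Lemma delta_h0E q (phi : cochain C 0 q) X Y Z (f : homs Y Z) (g : homs X Y) :
  delta_h phi (existT _ Y (f, g) : pathn 1 X Z)
  = Theta f g ∙ (id2 (T f) ⊙ phi _ _ g) - phi _ _ (comps f g) ∙ Theta f g
    + Theta f g ∙ (phi _ _ f ⊙ id2 (T g)).
Proof.
rewrite /delta_h big_ord_recl big_ord0 addr0 expr1 expr2 mulrN1 opprK.
(* For a sequence of length two, both boundaries of each cast are convertible, so the casts
   disappear. *)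
by rewrite scale1r scaleN1r !cast_id.
Qed.

(** Here [u] is an identity only up to strict equality, so the unit law does not apply to it
    directly; [cell_rect] replaces [u] by [id2 k]. *)
Lemma vcomp_cell_id2 (X Y X' Y' : Ob C) (f g h : Hom X Y) (k : Hom X' Y')
    (t : Hom2 f g) (u : Hom2 g h) :
  cell u = cell (id2 k) -> cell (u ∙ t) = cell t.
Proof.
move=> e; move: f t.
apply: (cell_rect (P := fun _ _ f' g' u => forall f (t : Hom2 f f'),
  cell (u ∙ t) = cell t) _ (esym e)) => f t.
by rewrite (vcomp1t C2).
Qed.

(** Θ_2 of a single pair is an identity by definition, and tensoring with identities preserves this.
    Hence no Θ_2 survives in [delta_v] on this row. *)
Lemma vslot0_id2 q i (X Y : obs C q.+1) (s : pathn 0 X Y) :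
  cell (tcell (vslot i s)) = cell (id2 (T (rcomp s))).
Proof.
elim: q i X Y s => [|q IHq] [|i] X Y s //=.
  rewrite (tens2_id2 CG); apply: cell_id2.
  exact: esym (tensA CG _ _ _).
rewrite -(tens2_id2 CG); exact: cell_tens2.
Qed.

Lemma delta_v0E q (phi : cochain C 0 q) (X Y : obs C q.+1) (s : pathn 0 X Y) :
  delta_v phi s
  = (id2 s.1 ⊠ phi _ _ s.2)
    + \sum_(i < q.+1) (-1) ^+ i.+1 *:
        cast (T_tmerge i s) (T_tmerge i s) (phi _ _ (tmerge i s))
    + (-1) ^+ q.+2 *:
        cast (T_belast s) (T_belast s) (phi _ _ (tbelast s) ⊠ id2 (tlast s)).
Proof.
rewrite /delta_v; congr (_ + _ + _ *: _).
- rewrite cast_id; exact: vcompt1 C2 _ _ _ _ _.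
- apply: eq_bigr => i _; congr (_ *: _).
  apply: cell_inj; rewrite !cell_cast.
  by rewrite (vcomp_cell_id2 _ (vslot0_id2 i s)) cell_cast.
apply: cell_inj; rewrite !cell_cast; congr cell.
exact: vcompt1 C2 _ _ _ _ _.
Qed.

End ZeroRow.

(** * Deformation axioms as conditions on cochains *)

Section Deformations.
Variables (K : comPzRingType) (C : graySemigroup K).

Let C2 := gray_2category C.
Let CG := gray_gray C.
Local Notation dualA := (@dual_tensA K C).

Definition cochain_of_family3 (a : family3 C) : cochain C 0 2 :=
  fun X Y s => a X.1 Y.1 X.2.1 Y.2.1 X.2.2 Y.2.2 s.1 s.2.1 s.2.2.
Definition family3_of_cochain (phi : cochain C 0 2) : family3 C :=
  fun X X' Y Y' Z Z' f g h => phi (X, (Y, Z)) (X', (Y', Z')) (f, (g, h)).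
Definition cochain_of_family2 (psi : family2 C) : cochain C 0 1 :=
  fun X Y s => psi X.1 Y.1 X.2 Y.2 s.1 s.2.
Definition family2_of_cochain (phi : cochain C 0 1) : family2 C :=
  fun X X' Y Y' f g => phi (X, Y) (X', Y') (f, g).

(** The nested tuples must be split before both sides compute to the same value, whence functional
    extensionality. The opposite composite is the identity by conversion. *)
Lemma family3_of_cochainK : cancel family3_of_cochain cochain_of_family3.
Proof.
move=> phi; apply: functional_extensionality_dep => -[X [Y Z]].
apply: functional_extensionality_dep => -[X' [Y' Z']].
by apply: functional_extensionality_dep => -[f [g h]].
Qed.

Lemma family2_of_cochainK : cancel family2_of_cochain cochain_of_family2.
Proof.
move=> phi; apply: functional_extensionality_dep => -[X Y].
apply: functional_extensionality_dep => -[X' Y'].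
by apply: functional_extensionality_dep => -[f g].
Qed.

(** The five terms are grouped by sign, as the right side minus the left side of the pentagon at
    order ε. *)
Lemma delta_v_family3 (a : family3 C) X X' Y Y' Z Z' W W' (f : Hom X X')
    (g : Hom Y Y') (h : Hom Z Z') (k : Hom W W') :
  delta_v (cochain_of_family3 a)
    ((f, (g, (h, k))) : @pathn K C 3 0 (X, (Y, (Z, W))) (X', (Y', (Z', W'))))
  = ((id2 f ⊠ a _ _ _ _ _ _ g h k)
     + cast (tens4A (tensA CG) f g h k) (tens4A (tensA CG) f g h k)
         (a _ _ _ _ _ _ f (g ⊗ h) k)
     + cast (tens4Al (tensA CG) f g h k) (tens4Al (tensA CG) f g h k)
         (a _ _ _ _ _ _ f g h ⊠ id2 k))
    - (a _ _ _ _ _ _ f g (h ⊗ k)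
       + castA (tensA CG) (a _ _ _ _ _ _ (f ⊗ g) h k)).
Proof.
rewrite delta_v0E.
set T0 := _ ⊠ _.
set T1 := cast _ _ (a _ _ _ _ _ _ f _ _).
set T2 := cast _ _ (_ ⊠ _).
set T3 := a _ _ _ _ _ _ f g (h ⊗ k).
set T4 := castA _ _.
rewrite 3!big_ord_recl big_ord0 addr0.
set U0 := cast _ _ _.
set U1 := cast _ _ _.
set U2 := cast _ _ _.
set U3 := cast _ _ _.
have -> : U0 = T4 by apply: cell_inj; rewrite !cell_cast.
have -> : U1 = T1 by apply: cell_inj; rewrite !cell_cast.
have -> : U2 = T3 by apply: cell_inj; rewrite !cell_cast.
have -> : U3 = T2 by apply: cell_inj; rewrite !cell_cast.
rewrite /= !exprS expr0 !mulN1r !opprK !scaleN1r !scale1r.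
(* The alternating sum is [T0 - T4 + T1 - T3 + T2]; the permutation moves the positive terms to the
   front. *)
by rewrite opprD !addrA [LHS](ACl (1*3*5*4*2)).
Qed.

(** The grouping follows the two sides of [psi_assoc] with the associators left out. *)
Lemma delta_v_family2 (psi : family2 C) X X' Y Y' Z Z' (f : Hom X X')
    (g : Hom Y Y') (h : Hom Z Z') :
  delta_v (cochain_of_family2 psi)
    ((f, (g, h)) : @pathn K C 2 0 (X, (Y, Z)) (X', (Y', Z')))
  = ((id2 f ⊠ psi _ _ _ _ g h) + psi _ _ _ _ f (g ⊗ h))
    - (castA (tensA CG) (psi _ _ _ _ f g ⊠ id2 h)
       + castA (tensA CG) (psi _ _ _ _ (f ⊗ g) h)).
Proof.
rewrite delta_v0E.
set T0 := _ ⊠ _.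
set T1 := psi _ _ _ _ f (g ⊗ h).
set T2 := castA _ _.
set T3 := castA _ _.
rewrite 2!big_ord_recl big_ord0 addr0.
set U0 := cast _ _ _.
set U1 := cast _ _ _.
set U2 := cast _ _ _.
have -> : U0 = T3 by apply: cell_inj; rewrite !cell_cast.
have -> : U1 = T1 by apply: cell_inj; rewrite !cell_cast.
have -> : U2 = T2 by apply: cell_inj; rewrite !cell_cast.
rewrite /= !exprS expr0 !mulN1r !opprK !scaleN1r !scale1r.
by rewrite opprD !addrA [LHS](ACl (1*3*4*2)).
Qed.

Lemma Theta2E X X' X'' Y Y' Y'' (f' : Hom X' X'') (g' : Hom Y' Y'')
    (f : Hom X X') (g : Hom Y Y') :
  @Theta K C 1 (X, Y) (X', Y') (X'', Y'') (f', g') (f, g) = hatT f' g' f g.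
Proof. by rewrite /= (tens2_id2 CG) (vcomp1t C2). Qed.

Lemma Theta3E X X' X'' Y Y' Y'' Z Z' Z''
    (f' : Hom X' X'') (g' : Hom Y' Y'') (h' : Hom Z' Z'')
    (f : Hom X X') (g : Hom Y Y') (h : Hom Z Z') :
  @Theta K C 2 (X, (Y, Z)) (X', (Y', Z')) (X'', (Y'', Z''))
    (f', (g', h')) (f, (g, h))
  = (id2 (f' ∘ f) ⊠ hatT g' h' g h) ∙ hatT f' (g' ⊗ h') f (g ⊗ h).
Proof. by rewrite /= (tens2_id2 CG) (vcomp1t C2). Qed.

(** Each of [natE], [compE] and [pentE] matches one instance of an axiom with one value of the
    corresponding cochain condition, so both directions only pack or unpack tuples. *)
Lemma is_associatorE (a : family3 C) :
  is_associator dualA (eps3 a) <->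
  in_Xass (cochain_of_family3 a) /\ cochain0 (delta_v (cochain_of_family3 a)).
Proof.
have natE X X' Y Y' Z Z' (f f' : Hom X X') (g g' : Hom Y Y')
    (h h' : Hom Z Z') t s r :
  eps3 a f' g' h' ∙ (t ⊠ s ⊠ r) = (t ⊠ s ⊠ r) ∙ eps3 a f g h <->
  a _ _ _ _ _ _ f' g' h' ∙ (t.1 ⊠ s.1 ⊠ r.1)
  = (t.1 ⊠ s.1 ⊠ r.1) ∙ a _ _ _ _ _ _ f g h := deform_naturalE _ _ _.
have compE X X' X'' Y Y' Y'' Z Z' Z''
      (f' : Hom X' X'') (g' : Hom Y' Y'') (h' : Hom Z' Z'')
      (f : Hom X X') (g : Hom Y Y') (h : Hom Z Z') :
    eps3 a (f' ∘ f) (g' ∘ g) (h' ∘ h)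
      ∙ cast (compA3 dualA f' g' h' f g h)
          (esym (dualA (f' ∘ f) (g' ∘ g) (h' ∘ h)))
          ((hatT f' g' f g ⊠ id2 (h' ∘ h)) ∙ hatT (f' ⊗ g') h' (f ⊗ g) h)
    = (id2 (f' ∘ f) ⊠ hatT g' h' g h)
      ∙ hatT f' (g' ⊗ h') f (g ⊗ h)
      ∙ (eps3 a f' g' h' ⊙ id2 (f ⊗ g ⊗ h))
      ∙ (id2 (f' ⊗ g' ⊗ h') ⊙ eps3 a f g h)
    <-> delta_h (cochain_of_family3 a) (existT _ (X', (Y', Z'))
      ((f', (g', h')), (f, (g, h)))
      : @pathn K C 2 1 (X, (Y, Z)) (X'', (Y'', Z''))) = 0.
  rewrite delta_h0E; set th := Theta _ _.
  (* Both ⊗̂ composites become the same [const th]: the left-bracketed one through [hatT_tens], the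
     right-bracketed one through [Theta3E]. Then [deform_compE] applies. *)
  have -> : cast (compA3 dualA f' g' h' f g h)
      (esym (dualA (f' ∘ f) (g' ∘ g) (h' ∘ h)))
      ((hatT f' g' f g ⊠ id2 (h' ∘ h)) ∙ hatT (f' ⊗ g') h' (f ⊗ g) h)
      = const th.
    rewrite [X in cast _ _ (X ∙ _)]const_tens2 [X in cast _ _ X]const_vcomp.
    rewrite cast_const.
    congr const; apply: cell_inj; rewrite cell_cast /th Theta3E.
    exact: (hatT_tens CG).
  have -> : (id2 (f' ∘ f) ⊠ hatT g' h' g h) ∙ hatT f' (g' ⊗ h') f (g ⊗ h)
      = const th.
    by rewrite /th Theta3E -const_vcomp -const_tens2.
  rewrite deform_hcompr deform_hcompl.
  exact: deform_compE.
have pentE X X' Y Y' Z Z' W W' (f : Hom X X')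
    (g : Hom Y Y') (h : Hom Z Z') (k : Hom W W') :
    eps3 a f g (h ⊗ k) ∙ castA dualA (eps3 a (f ⊗ g) h k)
    = (id2 f ⊠ eps3 a g h k)
      ∙ cast (tens4A dualA f g h k) (tens4A dualA f g h k)
          (eps3 a f (g ⊗ h) k)
      ∙ cast (tens4Al dualA f g h k) (tens4Al dualA f g h k)
          (eps3 a f g h ⊠ id2 k)
  <-> delta_v (cochain_of_family3 a)
    ((f, (g, (h, k)))
     : @pathn K C 3 0 (X, (Y, (Z, W))) (X', (Y', (Z', W')))) = 0.
  rewrite delta_v_family3 /castA deform_tens2l deform_tens2r !cast_deform.
  rewrite !deform_vcomp.
  (* The casts inherited from [dual C] and those of [delta_v_family3] carry different proofs of the
     same equalities; [castI] aligns them. *)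
  rewrite (castI _ (tens4A (tensA CG) f g h k) _ (tens4A (tensA CG) f g h k)).
  rewrite (castI _ (tens4Al (tensA CG) f g h k) _ (tens4Al (tensA CG) f g h k)).
  rewrite (castI _ (esym (tensA CG f g (h ⊗ k)))
                 _ (esym (tensA CG f g (h ⊗ k)))).
  split=> [/deform_inj -> | /subr0_eq ->] //; exact: subrr.
split=> [A | [[/natural0E nat_a /special0E id_a comp_a] pent_a]].
  split; last first.
    move=> [X [Y [Z W]]] [X' [Y' [Z' W']]] [f [g [h k]]].
    exact/pentE/(assoc_pentagon A).
  split; first (apply/natural0E).
  - move=> [X [Y Z]] [X' [Y' Z']] [f [g h]] [f' [g' h']] [t [s r]].
    (* Naturality in [C] is naturality in [dual C] tested on 2-cells without ε-part. *)
    exact: (natE _ _ _ _ _ _ _ _ _ _ _ _ (const t) (const s) (const r)).1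
      (assoc_natural A _ _ _).
  - by apply/special0E => -[X [Y Z]]; apply: deform_inj (assoc_id A X Y Z).
  move=> [X [Y Z]] [X'' [Y'' Z'']] [[X' [Y' Z']] [[f' [g' h']] [f [g h]]]].
  exact/compE/(assoc_comp A).
split=> *.
- exact: deform_iso.
- apply/natE.
  by apply: (nat_a (_, (_, _)) (_, (_, _)) (_, (_, _)) (_, (_, _)) (_, (_, _))).
- congr pair; exact: (id_a (_, (_, _))).
- exact/compE/comp_a.
exact/pentE/pent_a.
Qed.

(** Naturality, unit and composition reduce as for associators. In [psi_assoc] the two associators
    stand on opposite sides, so its ε-coefficient gives their difference as a coboundary. *)
Lemma is_psi_structureE (a a' : family3 C) (psi : family2 C) :
  is_psi_structure dualA (eps3 a) (eps3 a') (eps2 psi) <->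
  in_Xass (cochain_of_family2 psi) /\
  forall X Y (s : pathn 0 X Y),
    cochain_of_family3 a' s - cochain_of_family3 a s
    = delta_v (cochain_of_family2 psi) s.
Proof.
have natE X X' Y Y' (f f' : Hom X X') (g g' : Hom Y Y') t s :
  eps2 psi f' g' ∙ (t ⊠ s) = (t ⊠ s) ∙ eps2 psi f g <->
  psi _ _ _ _ f' g' ∙ (t.1 ⊠ s.1) = (t.1 ⊠ s.1) ∙ psi _ _ _ _ f g
  := deform_naturalE _ _ _.
have compE X X' X'' Y Y' Y'' (f' : Hom X' X'') (g' : Hom Y' Y'')
      (f : Hom X X') (g : Hom Y Y') :
    eps2 psi (f' ∘ f) (g' ∘ g) ∙ hatT f' g' f g
    = hatT f' g' f g ∙ (eps2 psi f' g' ⊙ id2 (f ⊗ g))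
      ∙ (id2 (f' ⊗ g') ⊙ eps2 psi f g)
    <-> delta_h (cochain_of_family2 psi) (existT _ (X', Y') ((f', g'), (f, g))
      : @pathn K C 1 1 (X, Y) (X'', Y'')) = 0.
  rewrite delta_h0E deform_hcompr deform_hcompl Theta2E.
  exact: deform_compE.
have assocE X X' Y Y' Z Z' (f : Hom X X') (g : Hom Y Y') (h : Hom Z Z') :
    (id2 f ⊠ eps2 psi g h) ∙ eps2 psi f (g ⊗ h) ∙ eps3 a f g h
    = eps3 a' f g h ∙ castA dualA (eps2 psi f g ⊠ id2 h)
      ∙ castA dualA (eps2 psi (f ⊗ g) h)
    <-> a' _ _ _ _ _ _ f g h - a _ _ _ _ _ _ f g h
        = delta_v (cochain_of_family2 psi)
            ((f, (g, h)) : @pathn K C 2 0 (X, (Y, Z)) (X', (Y', Z'))).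
  rewrite delta_v_family2 /castA deform_tens2l deform_tens2r !cast_deform.
  rewrite !deform_vcomp.
  rewrite !(castI _ (esym (tensA CG f g h)) _ (esym (tensA CG f g h))).
  (* Isolates the [a'] summand, to reach the left form of [addr_subr_swap]. *)
  rewrite -(addrA (a' _ _ _ _ _ _ f g h)).
  split=> [/deform_inj e | e]; first exact: (addr_subr_swap _ _ _ _).1 e.
  by rewrite ((addr_subr_swap _ _ _ _).2 e).
split=> [P | [[/natural0E nat_p /special0E id_p comp_p] assoc_p]].
  split; last first.
    by move=> [X [Y Z]] [X' [Y' Z']] [f [g h]]; apply/assocE/(psi_assoc P).
  split; first (apply/natural0E).
  - move=> [X Y] [X' Y'] [f g] [f' g'] [t s].
    exact: (natE _ _ _ _ _ _ _ _ (const t) (const s)).1 (psi_natural P _ _).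
  - by apply/special0E => -[X Y]; apply: deform_inj (psi_id P X Y).
  move=> [X Y] [X'' Y''] [[X' Y'] [[f' g'] [f g]]].
  exact/compE/(psi_comp P).
split=> *.
- exact: deform_iso.
- by apply/natE; apply: (nat_p (_, _) (_, _) (_, _) (_, _) (_, _)).
- congr pair; exact: (id_p (_, _)).
- exact/compE/comp_p.
exact/assocE/(assoc_p (_, (_, _)) (_, (_, _)) (_, (_, _))).
Qed.

(** * Mutually inverse maps between deformations and 2-cocycles, and passage to classes *)

Definition cocycle_of_deformation (a : associator_deformation C) :
    cocycle C 2 :=
  Cocycle ((is_associatorE _).1 (assoc1P a)).1
    ((is_associatorE _).1 (assoc1P a)).2.

Lemma family3_of_cocycleP (z : cocycle C 2) :
  is_associator dualA (eps3 (family3_of_cochain (cocycle_val z))).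
Proof.
apply/is_associatorE; rewrite family3_of_cochainK.
by split; [exact: cocycle_Xass | exact: cocycleP].
Qed.

Definition deformation_of_cocycle (z : cocycle C 2) :
    associator_deformation C :=
  AssociatorDeformation (family3_of_cocycleP z).

Lemma cocycle_of_deformationK :
  cancel cocycle_of_deformation deformation_of_cocycle.
Proof.
move=> [a aP]; rewrite /deformation_of_cocycle.
(* The two families agree by conversion, so only the proofs of the axioms remain to be compared. *)
move: (family3_of_cocycleP _) => aP'; congr AssociatorDeformation.
exact: proof_irrelevance.
Qed.

Lemma deformation_of_cocycleK :
  cancel deformation_of_cocycle cocycle_of_deformation.
Proof.
move=> [z zX zP]; rewrite /cocycle_of_deformation.
(* The proof components have types that mention the cochain being rewritten, so they are generalized
   first. *)
move: (_.1) (_.2); rewrite /= family3_of_cochainK => zX' zP'.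
by rewrite (proof_irrelevance _ zX' zX) (proof_irrelevance _ zP' zP).
Qed.

(** In degree 2 a coboundary witness lies in X^1_ass, which is the condition on the first-order part
    of ψ; both sides use the difference in the order [a'] minus [a]. *)
Lemma cohomologous_cocycle_of_deformation (a a' : associator_deformation C) :
  psi_equivalent a a' <->
  cohomologous (cocycle_of_deformation a) (cocycle_of_deformation a').
Proof.
split=> [[psi /is_psi_structureE [psiX psi_a]] | [phi phiX phi_a]].
  by exists (cochain_of_family2 psi).
exists (family2_of_cochain phi); apply/is_psi_structureE.
by rewrite family2_of_cochainK.
Qed.

End Deformations.

(* A class is transported by precomposing its predicate with the inverse
   bijection, so no representative is chosen. *)
Lemma classes_bijective (A B : Type) (R : A -> A -> Prop) (S : B -> B -> Prop)
    (f : A -> B) (g : B -> A) :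
  cancel f g -> cancel g f -> (forall a a', R a a' <-> S (f a) (f a')) ->
  exists F : classes R -> classes S, bijective F.
Proof.
move=> fK gK RS.
have FP (P : classes R) : exists b, (fun b' => sval P (g b')) = S b.
  case: P => P [a /= ->]; exists (f a).
  apply: functional_extensionality => b'.
  by apply: propositional_extensionality; rewrite RS gK.
have GP (Q : classes S) : exists a, (fun a' => sval Q (f a')) = R a.
  case: Q => Q [b /= ->]; exists (g b).
  apply: functional_extensionality => a'.
  by apply: propositional_extensionality; rewrite RS gK.
exists (fun P => exist _ (fun b => sval P (g b)) (FP P) : classes S).
exists (fun Q => exist _ (fun a => sval Q (f a)) (GP Q) : classes R) => -[P eP];
  apply: subset_eq_compat; apply: functional_extensionality => x /=.
- by rewrite fK.
- by rewrite gK.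
Qed.

Theorem theorem8p7 (K : comPzRingType) (C : graySemigroup K) :
  exists F : classes (@psi_equivalent K C) -> H_ass C 2, bijective F.
Proof.
exact: classes_bijective (@cocycle_of_deformationK K C)
  (@deformation_of_cocycleK K C) (@cohomologous_cocycle_of_deformation K C).
Qed.
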